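(* If $k\ge 2$, the linear pool, that is, the aggregation method $\{G_\theta:\theta\in\Delta_{k-1}\}$ with $G_{(w_1,\dots,w_k)}(F_1,\dots,F_k)=\sum_{i=1}^k w_iF_i$, fails to be flexibly dispersive relative to the class $\mathcal{F}_{\mathbb{R}}$ of all cumulative distribution functions on $\mathbb{R}$.
   Context: $\Delta_{k-1}=\{(w_1,\dots,w_k)\in\mathbb{R}^k: w_i\ge0,\ \sum_i w_i=1\}$ is the unit simplex. An aggregation method is a family $\mathcal{G}=\{G_\theta:\theta\in\Theta\}$ of mappings $G_\theta:\mathcal{F}^k\to\mathcal{F}$, where $\mathcal{F}$ is a common class of fixed (non-random) cumulative distribution functions (CDFs). For $k\ge2$, $\mathcal{G}$ is flexibly dispersive relative to $\mathcal{F}$ if for all $F_0\in\mathcal{F}$ and $F_1,\dots,F_k\in\mathcal{F}$ there exists $\theta\in\Theta$ such that, if $\mathcal{L}(Y)=F_0$ (the real random variable $Y$ has CDF $F_0$), then $G_\theta(F_1,\dots,F_k)$ is neutrally dispersed. A CDF $F$ is neutrally dispersed as a forecast for $Y$ if $\operatorname{var}(Z_F)=\frac1{12}$, where $Z_F=\lim_{y\uparrow Y}F(y)+V\bigl(F(Y)-\lim_{y\uparrow Y}F(y)\bigr)$ is the probability integral transform, with $V$ uniformly distributed on the unit interval and independent of $Y$. *)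

(* Defs.v *)
From HB Require Import structures.
From mathcomp Require Import all_boot all_order all_algebra.
From mathcomp Require Import all_classical all_reals all_analysis.

Set Implicit Arguments.
Unset Strict Implicit.
Unset Printing Implicit Defensive.

Import Order.TTheory GRing.Theory Num.Theory.
Import numFieldNormedType.Exports.

Local Open Scope classical_set_scope.
Local Open Scope ring_scope.

(* Right-continuous nondecreasing functions R -> R with limit 0 at -oo and 1 at
   +oo; they need not be strictly increasing or continuous. *)
Notation CDF R := (cumulativeBounded (0 : R) (1 : R)).

Definition unit_simplex (R : realType) (k : nat) : set 'rV[R]_k :=
  [set w | (forall i, 0 <= w ord0 i) /\ \sum_(i < k) w ord0 i = 1].
Arguments unit_simplex : clear implicits.

(* A class of CDFs is a set [FF], used as a type through the coercion
   [set_type], so that closure of [FF] under each [G theta] is part of the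
   typing. *)
Definition aggregation_method (R : realType) (FF : set (CDF R)) (k : nat)
    (Theta : Type) : Type :=
  Theta -> ('I_k -> FF) -> FF.

Definition independent_RVs (R : realType) (d : measure_display)
    (T : measurableType d) (P : probability T R) (X Y : {RV P >-> R}) : Prop :=
  forall A B : set R, measurable A -> measurable B ->
    P (X @^-1` A `&` Y @^-1` B) = (P (X @^-1` A) * P (Y @^-1` B))%E.

Definition standard_uniform (R : realType) (d : measure_display)
    (T : measurableType d) (P : probability T R) (V : {RV P >-> R}) : Prop :=
  forall A : set R, measurable A ->
    distribution P V A = uniform_prob (@ltr01 R) A.

Definition left_limit (R : realType) (F : R -> R) (y : R) : R :=
  lim (F x @[x --> y^'-]).

Definition PIT (R : realType) (T : Type) (F : R -> R) (Y V : T -> R) : T -> R :=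
  fun t => left_limit F (Y t) + V t * (F (Y t) - left_limit F (Y t)).

(* [V] is meant to be standard uniform and independent of [Y]; this is required
   in [flexibly_dispersive]. *)
Definition neutrally_dispersed (R : realType) (d : measure_display)
    (T : measurableType d) (P : probability T R) (Y V : {RV P >-> R})
    (F : CDF R) : Prop :=
  'V_P[PIT F Y V] = (1 / 12)%:E.

(* The variance of the PIT depends only on the joint law of (Y, V), which is
   determined by [F0]; hence quantifying over all probability spaces that carry
   such a pair is the same as fixing any one of them (e.g. the product of the
   law with CDF [F0] and the uniform law). *)
Definition flexibly_dispersive (R : realType) (FF : set (CDF R)) (k : nat)
    (Theta : Type) (G : aggregation_method FF k Theta) : Prop :=
  forall (F0 : FF) (F : 'I_k -> FF), exists theta : Theta,
    forall (d : measure_display) (T : measurableType d) (P : probability T R)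
      (Y V : {RV P >-> R}),
      (forall y : R, cdf Y y = (val F0 y)%:E) ->
      standard_uniform V -> independent_RVs Y V ->
      neutrally_dispersed Y V (val (G theta F)).

Section linear_pool.
Variables (R : realType) (k : nat).

Definition linear_comb (w : unit_simplex R k) (F : 'I_k -> CDF R) : R -> R :=
  fun x => \sum_(i < k) val w ord0 i * F i x.

Variables (w : unit_simplex R k) (F : 'I_k -> CDF R).

Let w_simplex : unit_simplex R k (val w).
Proof. exact: set_valP. Qed.

Let linear_comb_nd : nondecreasing (linear_comb w F).
Proof.
move=> x y xy; apply: ler_sum => i _; apply: ler_wpM2l.
  by case: w_simplex.
exact: cumulative_is_nondecreasing.
Qed.

Let linear_comb_cvg (H : set_system R) (l : 'I_k -> R) : Filter H ->
  (forall i, F i x @[x --> H] --> l i) ->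
  linear_comb w F x @[x --> H] --> \sum_(i < k) val w ord0 i * l i.
Proof.
move=> FH Fl; apply: cvg_big => [|i _]; first exact: add_continuous.
by apply: cvgM; [exact: cvg_cst|exact: Fl].
Qed.

Let linear_comb_rc : right_continuous (linear_comb w F).
Proof.
move=> x; apply: linear_comb_cvg => i.
exact: cumulative_is_right_continuous.
Qed.

HB.instance Definition _ :=
  isCumulative.Build R _ R (linear_comb w F) linear_comb_nd linear_comb_rc.

Let linear_combNy : linear_comb w F @ -oo --> (0 : R).
Proof.
rewrite [X in _ --> X](_ : 0 = \sum_(i < k) val w ord0 i * 0).
  by apply: linear_comb_cvg => i; exact: cumulativeNy.
by rewrite big1// => i _; rewrite mulr0.
Qed.

Let linear_comby : linear_comb w F @ +oo --> (1 : R).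
Proof.
rewrite [X in _ --> X](_ : 1 = \sum_(i < k) val w ord0 i * 1).
  by apply: linear_comb_cvg => i; exact: cumulativey.
by under eq_bigr do rewrite mulr1; case: w_simplex.
Qed.

HB.instance Definition _ :=
  isCumulativeBounded.Build R 0 1 (linear_comb w F) linear_combNy linear_comby.

End linear_pool.

Definition linear_pool (R : realType) (k : nat) :
    aggregation_method [set: CDF R] k (unit_simplex R k) :=
  fun w F => SigSub (mem_set (I : [set: CDF R] (linear_comb w (val \o F)))).

(* Main.v *)
From HB Require Import structures.
Require Import Defs.
From mathcomp Require Import all_boot all_order all_algebra.
From mathcomp Require Import all_classical all_reals all_analysis.

(** A linear pool of [k] copies of one CDF [F] is [F] again, whatever the
    weights: pooling experts who all agree leaves the parameter no freedom.  So
    it suffices to exhibit one forecast [F] and one outcome law [F0] for which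
    [F] is not neutrally dispersed.  Take [F] to be the point mass at 0 and [F0]
    the point mass at 1.  As [F] is constant, equal to 1, on a neighbourhood of
    1, there is no jump there for the randomization [V] to act on, and the
    probability integral transform of an outcome equal to 1 is the constant 1.
    Its variance is 0, not 1/12.

    Because [flexibly_dispersive] quantifies over all pairs (Y, V) with the
    prescribed law, refuting it also requires such a pair to exist: the uniform
    probability on the unit interval carries one, with [Y] constant and [V] the
    identity. *)

Set Implicit Arguments.
Unset Strict Implicit.
Unset Printing Implicit Defensive.

Import Order.TTheory GRing.Theory Num.Theory.
Import numFieldNormedType.Exports.

Local Open Scope classical_set_scope.
Local Open Scope ring_scope.

Section point_mass_cdf.
Variables (R : realType) (a : R).

Definition point_mass_cdf (x : R) : R := (a <= x)%R%:R.

Let point_mass_cdf_nd : nondecreasing point_mass_cdf.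
Proof.
move=> x y xy; rewrite /point_mass_cdf ler_nat.
by case: (leP a x) => // ax; rewrite (le_trans ax xy).
Qed.

Let point_mass_cdf_rc : right_continuous point_mass_cdf.
Proof.
move=> x; apply: cvg_near_cst; rewrite /point_mass_cdf.
have [ax|xa] := leP a x.
- near=> y; have xy : x <= y by near: y; exact: nbhs_right_ge.
  by rewrite (le_trans ax xy).
- near=> y; have ya : y < a by near: y; exact: nbhs_right_lt.
  by rewrite leNgt ya.
Unshelve. all: by end_near. Qed.

HB.instance Definition _ := isCumulative.Build R _ R point_mass_cdf
  point_mass_cdf_nd point_mass_cdf_rc.

Let point_mass_cdfNy : point_mass_cdf @ -oo --> (0 : R).
Proof.
apply: cvg_near_cst; near=> y.
have ya : y < a by near: y; apply: nbhs_ninfty_lt; exact: num_real.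
by rewrite /point_mass_cdf leNgt ya.
Unshelve. all: by end_near. Qed.

Let point_mass_cdfy : point_mass_cdf @ +oo --> (1 : R).
Proof.
apply: cvg_near_cst; near=> y.
have ay : a <= y by near: y; apply: nbhs_pinfty_ge; exact: num_real.
by rewrite /point_mass_cdf ay.
Unshelve. all: by end_near. Qed.

HB.instance Definition _ := isCumulativeBounded.Build R 0 1 point_mass_cdf
  point_mass_cdfNy point_mass_cdfy.

Lemma left_limit_point_mass_cdf (y : R) :
  a < y -> left_limit point_mass_cdf y = 1.
Proof.
move=> ay; apply: norm_lim_near_cst.
near=> x.
have ax : a <= x by near: x; exact: nbhs_left_ge.
by rewrite /point_mass_cdf ax.
Unshelve. all: by end_near. Qed.

End point_mass_cdf.

(** The weights factor out of the sum and add up to 1. *)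
Lemma linear_comb_cst (R : realType) (k : nat) (w : unit_simplex R k)
  (F : CDF R) : linear_comb w (fun=> F) = F :> (R -> R).
Proof.
apply/funext => x; rewrite /linear_comb -mulr_suml.
by have [_ ->] : unit_simplex R k (val w) by [exact: set_valP]; rewrite mul1r.
Qed.

(** The CDF is locally constant to the right of its atom, so it has no jump at
    [b] and the term carrying [V] vanishes. *)
Lemma PIT_point_mass_cdf (R : realType) (T : Type) (a b : R) (V : T -> R) :
  a < b -> PIT (point_mass_cdf a) (cst b) V = cst 1.
Proof.
move=> ab; apply/funext => t; rewrite /PIT/= left_limit_point_mass_cdf//.
by rewrite /point_mass_cdf (ltW ab) subrr mulr0 addr0.
Qed.

Section random_variables.
Context d (T : measurableType d) (R : realType) (P : probability T R).

Lemma cdf_cst (b y : R) :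
  cdf (cst b : {RV P >-> R}) y = (point_mass_cdf b y)%:E.
Proof.
rewrite /cdf /distribution /pushforward /point_mass_cdf preimage_cst mem_setE.
by rewrite in_itv/=; case: ifP => _; rewrite ?probability_setT ?measure0.
Qed.

Lemma independent_RVs_cst (b : R) (V : {RV P >-> R}) :
  independent_RVs (cst b : {RV P >-> R}) V.
Proof.
move=> A B mA mB; rewrite preimage_cst; case: ifP => _.
- by rewrite setTI probability_setT mul1e.
- by rewrite set0I measure0 mul0e.
Qed.

End random_variables.

Theorem theorem3p3 (R : realType) (k : nat) (hk : (2 <= k)%N) :
  ~ flexibly_dispersive (@linear_pool R k).
Proof.
pose cdf_at (a : R) : [set: CDF R] :=
  SigSub (mem_set (I : [set: CDF R] (point_mass_cdf a))).
move=> /(_ (cdf_at 1) (fun=> cdf_at 0))[w].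
pose P : probability _ R := uniform_prob (@ltr01 R).
pose id_mfun := isMeasurableFun.Build _ _ _ _
  (idfun : measurableTypeR R -> R) (@measurable_id _ _ setT).
pose V : {RV P >-> R} := HB.pack (idfun : measurableTypeR R -> R) id_mfun.
move=> /(_ _ _ P (cst 1) V (cdf_cst P 1)).
have unifV : standard_uniform V by [].
move=> /(_ unifV (independent_RVs_cst 1 V)).
rewrite /neutrally_dispersed /= linear_comb_cst/= PIT_point_mass_cdf//.
rewrite variance_cst => /esym/eqP.
by rewrite eqe mul1r invr_eq0 pnatr_eq0.
Qed.
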